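(* Let $\Pi$ be a relational signature, let $\mathbb{T}$ be a relational Horn theory without equality over $\Pi$, and let $h : X \to Y$ be a morphism in $\mathbb{T}\text{-}\mathsf{Mod}$. Then $h$ is an embedding if and only if $h$ is injective and reflects relations, while $h$ is a quotient morphism if and only if $h$ is surjective and $\mathsf{E}(Y)$ is the $\mathbb{T}$-closure of $h \cdot \mathsf{E}(X)$.
   Context: A relational signature is a set $\Pi$ of relation symbols together with an assignment to each relation symbol of a finite arity, a positive integer $n \geq 1$. A $\Pi$-edge in a set $S$ is a pair $(R, (s_1, \ldots, s_n))$ with $R \in \Pi$ of arity $n$ and $(s_1, \ldots, s_n) \in S^n$. A $\Pi$-structure $X$ is a set $|X|$ together with a set $\mathsf{E}(X)$ of $\Pi$-edges in $|X|$. We write $X \models R x_1 \ldots x_n$ if $(R, (x_1, \ldots, x_n)) \in \mathsf{E}(X)$. For a function $h : S \to S'$ and an edge $e = (R, (s_1, \ldots, s_n))$ in $S$, write $h \cdot e := (R, (h(s_1), \ldots, h(s_n)))$; for a set $E$ of edges in $S$, write $h \cdot E := \{h \cdot e \mid e \in E\}$. A $\Pi$-morphism $h : X \to Y$ of $\Pi$-structures is a function $h : |X| \to |Y|$ such that $h \cdot \mathsf{E}(X) \subseteq \mathsf{E}(Y)$. $\mathsf{Str}(\Pi)$ is the category of $\Pi$-structures and $\Pi$-morphisms. Let $\lambda$ be a regular cardinal and let $\mathrm{Var}$ be a set of variables of cardinality $\lambda$. A $\lambda$-ary Horn formula without equality over $\Pi$ is an expression $\Phi \Longrightarrow \psi$,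 where $\Phi$ is a set of $\Pi$-edges in $\mathrm{Var}$ of cardinality $< \lambda$ and $\psi$ is a $\Pi$-edge in $\mathrm{Var}$. A relational Horn theory without equality over $\Pi$ is a set $\mathbb{T}$ of such formulas (its axioms), for some regular cardinal $\lambda$. A $\Pi$-structure $X$ is a $\mathbb{T}$-model if for every axiom $\Phi \Longrightarrow \psi$ of $\mathbb{T}$ and every function $\kappa : \mathrm{Var} \to |X|$ with $\kappa \cdot \varphi \in \mathsf{E}(X)$ for all $\varphi \in \Phi$, we have $\kappa \cdot \psi \in \mathsf{E}(X)$. $\mathbb{T}\text{-}\mathsf{Mod}$ is the full subcategory of $\mathsf{Str}(\Pi)$ on the $\mathbb{T}$-models. A $\mathbb{T}$-relation on a set $S$ is a set $\mathcal{E}$ of $\Pi$-edges in $S$ such that for every axiom $\Phi \Longrightarrow \psi$ of $\mathbb{T}$ and every function $\kappa : \mathrm{Var} \to S$ with $\kappa \cdot \varphi \in \mathcal{E}$ for all $\varphi \in \Phi$, we have $\kappa \cdot \psi \in \mathcal{E}$. The $\mathbb{T}$-closure of a set $\mathcal{E}$ of $\Pi$-edges in $S$ is the smallest $\mathbb{T}$-relation on $S$ containing $\mathcal{E}$. In the statement the $\mathbb{T}$-closure is taken on the set $|Y|$. A morphism is injective (surjective) if its underlying function is. A morphism $h : X \to Y$ of $\mathbb{T}\text{-}\mathsf{Mod}$ is initial if for every $\mathbb{T}$-model $Z$ and every function $g : |Z| \to |X|$, $g$ is a $\Pi$-morphism $Z \to X$ iff $h \circ g$ is a $\Pi$-morphism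 $Z \to Y$; it is final if for every $\mathbb{T}$-model $Z$ and every function $g : |Y| \to |Z|$, $g$ is a $\Pi$-morphism $Y \to Z$ iff $g \circ h$ is a $\Pi$-morphism $X \to Z$. An embedding is an injective morphism that is initial; a quotient morphism is a surjective morphism that is final. A $\Pi$-morphism $h : X \to Y$ reflects relations if for each $R \in \Pi$ of arity $n \geq 1$ and all $x_1, \ldots, x_n \in |X|$, $Y \models R h(x_1) \ldots h(x_n)$ implies $X \models R x_1 \ldots x_n$. *)

(* Defs.v *)
From mathcomp Require Import all_boot boolp classical_sets functions cardinality.

Set Implicit Arguments.
Unset Strict Implicit.
Unset Printing Implicit Defensive.

Local Open Scope classical_set_scope.
Local Open Scope card_scope.

Record signature := Signature {
  relsym :> Type;
  arity : relsym -> nat;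
  arity_gt0 : forall R : relsym, 0 < arity R }.

Definition edge (Pi : signature) (S : Type) : Type :=
  {R : Pi & (arity R).-tuple S}.

Definition Edge (Pi : signature) (S : Type) (R : Pi)
    (s : (arity R).-tuple S) : edge Pi S :=
  existT (fun R : Pi => (arity R).-tuple S) R s.

(* [edge_map h e] is h . e; the set h . E is the image [edge_map h @` E]. *)
Definition edge_map (Pi : signature) (S S' : Type) (h : S -> S')
    (e : edge Pi S) : edge Pi S' :=
  Edge (map_tuple h (projT2 e)).

Record structure (Pi : signature) := Structure {
  carrier :> Type;
  edges : set (edge Pi carrier) }.

Arguments edges {Pi} X : rename.

Definition holds (Pi : signature) (X : structure Pi) (R : Pi)
    (x : (arity R).-tuple X) : Prop :=
  edges X (Edge x).

Arguments holds {Pi} X R x.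

Definition is_morphism (Pi : signature) (X Y : structure Pi) (h : X -> Y) :
    Prop :=
  edge_map h @` edges X `<=` edges Y.

Definition reflects_relations (Pi : signature) (X Y : structure Pi)
    (h : X -> Y) : Prop :=
  forall (R : Pi) (x : (arity R).-tuple X),
    holds Y R (map_tuple h x) -> holds X R x.

Definition card_lt (T U : Type) (A : set T) (B : set U) : Prop :=
  A #<= B /\ ~ (B #<= A).

(* A cardinal is represented by a type of that cardinality.  It is regular if
   it is infinite and every union of fewer than |K| sets, each of cardinality
   less than |K|, has cardinality less than |K|. *)
Definition regular_cardinal (K : Type) : Prop :=
  infinite_set [set: K] /\
  forall (I T : Type) (D : set I) (F : I -> set T),
    card_lt D [set: K] -> (forall i, D i -> card_lt (F i) [set: K]) ->
    card_lt (\bigcup_(i in D) F i) [set: K].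

Record horn_formula (Pi : signature) (Var : Type) := HornFormula {
  premises : set (edge Pi Var);
  premises_small : card_lt premises [set: Var];
  conclusion : edge Pi Var }.

(* The regular cardinal lambda is the cardinality of [var]. *)
Record horn_theory (Pi : signature) := HornTheory {
  var : Type;
  var_regular : regular_cardinal var;
  axioms : set (horn_formula Pi var) }.

Section Models.
Variables (Pi : signature) (TT : horn_theory Pi).

Definition is_T_relation (S : Type) (E : set (edge Pi S)) : Prop :=
  forall a : horn_formula Pi (var TT), axioms a ->
  forall kappa : var TT -> S,
    (forall phi, premises a phi -> E (edge_map kappa phi)) ->
    E (edge_map kappa (conclusion a)).

Definition is_T_model (X : structure Pi) : Prop := is_T_relation (edges X).

Definition T_closure (S : Type) (E : set (edge Pi S)) : set (edge Pi S) :=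
  smallest (@is_T_relation S) E.

Lemma T_closure_is_T_relation (S : Type) (E : set (edge Pi S)) :
  is_T_relation (T_closure E).
Proof.
move=> a aT kappa prem M [MT EM].
by apply: (MT a aT kappa) => phi /prem; apply.
Qed.

Definition initial (X Y : structure Pi) (h : X -> Y) : Prop :=
  forall Z : structure Pi, is_T_model Z -> forall g : Z -> X,
    is_morphism g <-> is_morphism (h \o g).

Definition final (X Y : structure Pi) (h : X -> Y) : Prop :=
  forall Z : structure Pi, is_T_model Z -> forall g : Y -> Z,
    is_morphism g <-> is_morphism (g \o h).

Definition surjective (A B : Type) (h : A -> B) : Prop :=
  set_surj [set: A] [set: B] h.

Definition embedding (X Y : structure Pi) (h : X -> Y) : Prop :=
  injective h /\ initial h.

Definition quotient_morphism (X Y : structure Pi) (h : X -> Y) : Prop :=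
  surjective h /\ final h.

End Models.

(* Main.v *)
Require Import Defs.
From mathcomp Require Import all_boot boolp classical_sets functions cardinality.
Local Open Scope classical_set_scope.

(** Both equivalences rest on the stability of [T]-relations under preimage:
    if [E] is a [T]-relation on [S'] and [f : S -> S'], then the edges of [S]
    sent into [E] by [f] form a [T]-relation on [S]
    ([preimage_is_T_relation]).  This holds because a valuation of the
    variables in [S] composed with [f] is a valuation in [S'].

    Preimages give initiality.  The preimage of [edges Y] along [h] makes the
    carrier of [X] a model [Z] for which [h : Z -> Y] is a morphism; if [h] is
    initial then the identity is a morphism [Z -> X], which is exactly
    reflection of relations.  Conversely, if [h] reflects relations, an edge of
    [X] is present as soon as its image under [h] is, so [g] is a morphism
    whenever [h \o g] is.

    Finality is dual, with the closure of the image of [edges X] in the role of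
    the preimage: this closure makes the carrier of [Y] a model [Z] for which
    [h : X -> Z] is a morphism, so finality of [h] makes the identity a
    morphism [Y -> Z].  Conversely, if [edges Y] is that closure and [g \o h]
    is a morphism into a model [Z], then the preimage of [edges Z] along [g] is
    a [T]-relation containing the image of [edges X], hence all of [edges Y]. *)

Lemma edge_map_id (Pi : signature) (S : Type) (e : edge Pi S) :
  edge_map id e = e.
Proof.
by case: e => R s; congr existT; apply: val_inj; rewrite /= map_id.
Qed.

Lemma edge_map_comp (Pi : signature) (S S' S'' : Type)
    (g : S' -> S'') (f : S -> S') (e : edge Pi S) :
  edge_map (g \o f) e = edge_map g (edge_map f e).
Proof. by congr existT; apply: val_inj; rewrite /= map_comp. Qed.

Lemma is_morphismE (Pi : signature) (X Y : structure Pi) (h : X -> Y) :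
  is_morphism h <-> forall e, edges X e -> edges Y (edge_map h e).
Proof.
split=> [hm e Xe|hm _ [e Xe <-]]; last exact: hm.
by apply: hm; exists e.
Qed.

Lemma is_morphism_comp (Pi : signature) (X Y Z : structure Pi)
    (g : Y -> Z) (f : X -> Y) :
  is_morphism g -> is_morphism f -> is_morphism (g \o f).
Proof.
move=> /is_morphismE gm /is_morphismE fm; apply/is_morphismE => e Xe.
by rewrite edge_map_comp; apply/gm/fm.
Qed.

Lemma reflects_relationsE (Pi : signature) (X Y : structure Pi) (h : X -> Y) :
  reflects_relations h <-> forall e, edges Y (edge_map h e) -> edges X e.
Proof. by split=> [hr [R x]|hr R x]; [apply: hr|apply: (hr (Edge x))]. Qed.

(** This is the source of every model needed for initiality, and what lets
    [T_closure] be bounded above by a preimage. *)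
Lemma preimage_is_T_relation (Pi : signature) (TT : horn_theory Pi)
    (S S' : Type) (f : S -> S') (E : set (edge Pi S')) :
  is_T_relation TT E -> is_T_relation TT (edge_map f @^-1` E).
Proof.
move=> ET a aT kappa prem; rewrite /preimage /= -edge_map_comp.
by apply: ET => // phi /prem; rewrite /preimage /= -edge_map_comp.
Qed.

Lemma initialP (Pi : signature) (TT : horn_theory Pi) (X Y : structure Pi)
    (h : X -> Y) :
  is_T_model TT Y -> is_morphism h ->
  initial TT h <-> reflects_relations h.
Proof.
move=> YT hm; rewrite reflects_relationsE; split=> [hi e Ye|hr Z ZT g].
(* [Z] has the most edges for which [h] is still a morphism into [Y]. *)
- pose Z := Structure (edge_map h @^-1` edges Y).
  have ZT : is_T_model TT Z by apply: preimage_is_T_relation.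
  have /is_morphismE idm : @is_morphism Pi Z X id.
    by apply/(hi Z ZT id)/is_morphismE.
  by rewrite -(edge_map_id _ _ e); apply: idm.
- split=> [|/is_morphismE hgm]; first exact: is_morphism_comp.
  by apply/is_morphismE => e Ze; apply: hr; rewrite -edge_map_comp; apply: hgm.
Qed.

Lemma finalP (Pi : signature) (TT : horn_theory Pi) (X Y : structure Pi)
    (h : X -> Y) :
  is_T_model TT Y -> is_morphism h ->
  final TT h <-> edges Y = T_closure TT (edge_map h @` edges X).
Proof.
move=> YT hm; split=> [hf|YE Z ZT g].
(* [Z] has the fewest edges for which it is a model and [h] is still a
   morphism from [X]. *)
- pose Z := Structure (T_closure TT (edge_map h @` edges X)).
  have ZT : is_T_model TT Z by apply: T_closure_is_T_relation.
  have hZ : @is_morphism Pi X Z h by apply: sub_smallest.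
  apply/seteqP; split=> [e Ye|]; last exact: smallest_sub.
  have /is_morphismE idm : @is_morphism Pi Y Z id by apply/(hf Z ZT id).
  by rewrite -(edge_map_id _ _ e); apply: idm.
- split=> [gm|/is_morphismE ghm]; first exact: is_morphism_comp.
  apply/is_morphismE; rewrite YE; apply: smallest_sub.
    exact: preimage_is_T_relation.
  by move=> _ [e Xe <-]; rewrite /preimage /= -edge_map_comp; apply: ghm.
Qed.

Theorem proposition4p8 (Pi : signature) (TT : horn_theory Pi)
    (X Y : structure Pi) (X_model : is_T_model TT X) (Y_model : is_T_model TT Y)
    (h : X -> Y) (h_morphism : is_morphism h) :
  (embedding TT h <-> injective h /\ reflects_relations h) /\
  (quotient_morphism TT h <->
     surjective h /\ edges Y = T_closure TT (edge_map h @` edges X)).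
Proof.
by rewrite /embedding /quotient_morphism initialP // finalP.
Qed.
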